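(* For integers $s,t\ge 0$ define $$m_{i,j}^{s,t}=\int_{(0,1)^2}\frac{x^{s+i}y^{s+j}}{x+y}\left(\frac{1-x}{1+x}\right)^t\left(\frac{1-y}{1+y}\right)^t\,dx\,dy\qquad(i,j\ge 0),$$ and $\tau_n^{s,t}=\det\big(m_{i,j}^{s,t}\big)_{i,j=0}^{n-1}$ for $n\ge 1$, with $\tau_0^{s,t}=1$. Then for all integers $n\ge 1$ and $s,t\ge 0$, the quantities $\tau_n^{s,t}$ satisfy the discrete CKP equation $$ \begin{aligned} &4\left(\tau_{n}^{s+1,t}\tau_n^{s,t}-\tau_{n+1}^{s,t}\tau_{n-1}^{s+1,t}\right)\left(\tau_n^{s+1,t+1}\tau_n^{s,t+1}-\tau_{n+1}^{s,t+1}\tau_{n-1}^{s+1,t+1}\right)\\ &\qquad=\left(\tau_n^{s+1,t}\tau_n^{s,t+1}+\tau_n^{s+1,t+1}\tau_n^{s,t}-\tau_{n+1}^{s,t+1}\tau_{n-1}^{s+1,t}-\tau_{n+1}^{s,t}\tau_{n-1}^{s+1,t+1}\right)^2. \end{aligned} $$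
   Context: The numbers $\tau_n^{s,t}$ are the normalization factors (Gram determinants of bi-moments) of the Cauchy bi-orthogonal polynomials with the deformed Jacobi weight $x^s\big((1-x)/(1+x)\big)^t$ on $(0,1)$ and Cauchy kernel $1/(x+y)$. The empty determinant $\tau_0^{s,t}$ is taken to be $1$. *)

(* Defs.v *)
From mathcomp Require Import all_boot all_order all_algebra.
From mathcomp Require Import all_classical all_reals all_analysis.
Set Implicit Arguments. Unset Strict Implicit. Unset Printing Implicit Defensive.
Import Order.TTheory GRing.Theory Num.Theory.
Import numFieldNormedType.Exports.
Local Open Scope classical_set_scope.
Local Open Scope ring_scope.

Definition djac (R : realType) (t : nat) (x : R) : R := ((1 - x) / (1 + x)) ^+ t.

(* bi-moment m_{i,j}^{s,t} : Lebesgue integral over (0,1)^2 w.r.t. the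
   product Lebesgue measure (real-valued; the integrand is nonnegative and
   integrable). *)
Definition bimoment (R : realType) (s t i j : nat) : R :=
  Rintegral ((@lebesgue_measure R) \x (@lebesgue_measure R))%E
    (`]0%R, 1%R[ `*` `]0%R, 1%R[)
    (fun p : R * R => p.1 ^+ (s + i) * p.2 ^+ (s + j) / (p.1 + p.2)
                      * djac t p.1 * djac t p.2).

(* tau_n^{s,t} = det (m_{i,j}^{s,t})_{0<=i,j<n}; the 0x0 determinant is 1. *)
Definition tau (R : realType) (s t n : nat) : R :=
  \det (\matrix_(i < n, j < n) bimoment R s t i j).

(* Main.v *)
Require Import Defs.
From mathcomp Require Import all_boot all_order all_algebra.
From mathcomp Require Import all_classical all_reals all_analysis.
From mathcomp Require Import measurable_realfun ring lra.
Import Order.TTheory GRing.Theory Num.Theory.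
Import numFieldNormedType.Exports.
Local Open Scope classical_set_scope.
Local Open Scope ring_scope.
Set Implicit Arguments. Unset Strict Implicit. Unset Printing Implicit Defensive.

(* Since (1-x)(1-y) = (1+x)(1+y) - 2(x+y), raising t by one changes the bimoment
   matrix m by the rank-one term -2 p p^T, where p_i is the integral of
   x^(s+i) / (1+x) * ((1-x)/(1+x))^t.  Along the pencil m - l p p^T all the
   determinants involved are affine in l, and by symmetry of m the
   Desnanot-Jacobi identity equates each factor of the left-hand side with the
   square D(l)^2 of a shifted determinant, at l = 0 and l = 2.  The expression
   squared on the right-hand side is the polarization of this quadratic
   identity, hence equals 2 D(0) D(2). *)

(** * Determinants of leading sections of infinite arrays *)

(** Entries are indexed by naturals, so that a shifted minor is the same determinant of a shifted
    array and the size can vary without casts between ordinals. *)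
Definition ndet (R : comNzRingType) (f : nat -> nat -> R) (n : nat) : R :=
  \det (\matrix_(i < n, j < n) f i j).

Lemma eq_ndet (R : comNzRingType) (f g : nat -> nat -> R) n :
  (forall i j, (i < n)%N -> (j < n)%N -> f i j = g i j) -> ndet f n = ndet g n.
Proof.
by move=> fg; congr (\det _); apply/matrixP => i j; rewrite !mxE fg.
Qed.

Lemma ndet_tr (R : comNzRingType) (f : nat -> nat -> R) n :
  ndet (fun i j => f j i) n = ndet f n.
Proof.
by rewrite /ndet -det_tr; congr (\det _); apply/matrixP => i j; rewrite !mxE.
Qed.

Lemma rmorph_ndet (R S : comNzRingType) (h : {rmorphism R -> S})
    (f : nat -> nat -> R) n :
  h (ndet f n) = ndet (fun i j => h (f i j)) n.
Proof.
by rewrite /ndet -det_map_mx; congr (\det _); apply/matrixP => i j; rewrite !mxE.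
Qed.

Section Minors.
Variables (R : comNzRingType) (f : nat -> nat -> R) (n : nat).
Let M := \matrix_(i < n.+1, j < n.+1) f i j.

Lemma cofactor_00 : cofactor M ord0 ord0 = ndet (fun i j => f i.+1 j.+1) n.
Proof.
rewrite /cofactor expr0 mul1r; congr (\det _).
by apply/matrixP => i j; rewrite !mxE !lift0.
Qed.

Lemma cofactor_maxmax : cofactor M ord_max ord_max = ndet f n.
Proof.
rewrite /cofactor /= -signr_odd oddD addbb expr0 mul1r; congr (\det _).
by apply/matrixP => i j; rewrite !mxE !lift_max.
Qed.

Lemma cofactor_0max :
  cofactor M ord0 ord_max = (-1) ^+ n * ndet (fun i j => f i.+1 j) n.
Proof.
rewrite /cofactor /= add0n; congr (_ * \det _).
by apply/matrixP => i j; rewrite !mxE lift0 lift_max.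
Qed.

Lemma cofactor_max0 :
  cofactor M ord_max ord0 = (-1) ^+ n * ndet (fun i j => f i j.+1) n.
Proof.
rewrite /cofactor /= addn0; congr (_ * \det _).
by apply/matrixP => i j; rewrite !mxE lift0 lift_max.
Qed.

Lemma ndet_col0 : (forall i, (0 < i <= n)%N -> f i 0 = 0) ->
  ndet f n.+1 = f 0 0 * ndet (fun i j => f i.+1 j.+1) n.
Proof.
move=> f0; rewrite /ndet -/M (expand_det_col _ ord0) big_ord_recl cofactor_00 mxE.
rewrite big1 ?addr0// => i _.
by rewrite mxE f0 ?mul0r// lift0/= ltn_ord.
Qed.

Lemma ndet_colmax : (forall i, (i < n)%N -> f i n = 0) ->
  ndet f n.+1 = f n n * ndet f n.
Proof.
move=> f0; rewrite /ndet -/M (expand_det_col _ ord_max) big_ord_recr cofactor_maxmax mxE/=.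
by rewrite big1 ?add0r// => i _; rewrite mxE f0 ?mul0r/=.
Qed.

Lemma ndet_rowmax : (forall j, (j < n)%N -> f n j = 0) ->
  ndet f n.+1 = f n n * ndet f n.
Proof.
move=> f0; rewrite /ndet -/M (expand_det_row _ ord_max) big_ord_recr cofactor_maxmax mxE/=.
by rewrite big1 ?add0r// => i _; rewrite mxE f0 ?mul0r/=.
Qed.

Lemma ndet_rowmax0 : (forall j, (0 < j <= n)%N -> f n j = 0) ->
  ndet f n.+1 = (-1) ^+ n * f n 0 * ndet (fun i j => f i j.+1) n.
Proof.
move=> f0; rewrite /ndet -/M (expand_det_row _ ord_max) big_ord_recl cofactor_max0 mxE.
rewrite big1 ?addr0 => [|i _]; first by rewrite mulrCA mulrA.
by rewrite mxE f0 ?mul0r// lift0/= ltn_ord.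
Qed.

End Minors.

Lemma ndet_row0max (R : comNzRingType) (f : nat -> nat -> R) n :
  (forall j, (0 < j <= n)%N -> f 0 j = 0) ->
  ndet f n.+2 = f 0 0 * ndet (fun i j => f i.+1 j.+1) n.+1
    + (-1) ^+ n.+1 * f 0 n.+1 * ndet (fun i j => f i.+1 j) n.+1.
Proof.
move=> f0; rewrite /ndet (expand_det_row _ ord0) big_ord_recl big_ord_recr/=.
have -> : lift ord0 ord_max = ord_max :> 'I_n.+2 by apply: val_inj.
rewrite cofactor_00 cofactor_0max !mxE/= big1 ?add0r; last first.
  by move=> i _; rewrite mxE f0 ?mul0r// lift0/=.
by rewrite mulrCA mulrA.
Qed.

(** * The Desnanot-Jacobi identity *)

Lemma ndet_delta (R : comNzRingType) n :
  ndet (fun i j => (i == j)%:R : R) n = 1.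
Proof.
rewrite /ndet -[RHS](det1 R n); congr (\det _).
by apply/matrixP => i j; rewrite !mxE.
Qed.

(* Multiply the matrix M of f by the identity matrix with its two extreme
   columns replaced by those of adj M, and take determinants. *)
Lemma desnanot_jacobi_adj (R : comNzRingType) (f : nat -> nat -> R) n :
  ndet f n.+2 * (ndet f n.+2 * ndet (fun i j => f i.+1 j.+1) n)
  = ndet f n.+2 * (ndet f n.+1 * ndet (fun i j => f i.+1 j.+1) n.+1
      - ndet (fun i j => f i.+1 j) n.+1 * ndet (fun i j => f i j.+1) n.+1).
Proof.
pose M := \matrix_(i < n.+2, j < n.+2) f i j.
(* [inord] makes the adjugate an array over the naturals; only indices up to [n.+1] occur, where it
   is faithful. *)
pose a (i : nat) (j : 'I_n.+2) := \adj M (inord i) j.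
pose P i j := if j == 0%N then a i ord0 else if j == n.+1 then a i ord_max
              else (i == j)%:R.
pose Q i j := if j == 0%N then ndet f n.+2 *+ (i == 0%N) else
              if j == n.+1 then ndet f n.+2 *+ (i == n.+1) else f i j.
have MPQ : M *m (\matrix_(i < n.+2, j < n.+2) P i j) = \matrix_(i < n.+2, j < n.+2) Q i j.
  have Madj (i k : 'I_n.+2) :
      \sum_j M i j * a j k = ndet f n.+2 *+ (i == k).
    have := congr1 (fun A : 'M[R]_n.+2 => A i k) (mul_mx_adj M).
    rewrite !mxE /ndet -/M => <-; apply: eq_bigr => j _.
    by rewrite /a inord_val.
  apply/matrixP => i k; rewrite !mxE /Q /P.
  case: eqP => k0.
    rewrite -(Madj i ord0); apply: eq_bigr => j _.
    by rewrite [X in _ * X]mxE k0.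
  case: eqP => kn.
    rewrite -(Madj i ord_max); apply: eq_bigr => j _.
    by rewrite [X in _ * X]mxE (introF eqP k0) kn eqxx.
  rewrite (bigD1 k)//= big1 ?addr0 => [|j jk].
    by rewrite !mxE (introF eqP k0) (introF eqP kn) eqxx mulr1.
  rewrite [X in _ * X]mxE (introF eqP k0) (introF eqP kn).
  by rewrite (_ : (j == k :> nat) = false) ?mulr0//; apply/negbTE.
have detP : ndet P n.+2 = ndet f n.+1 * ndet (fun i j => f i.+1 j.+1) n.+1
      - ndet (fun i j => f i.+1 j) n.+1 * ndet (fun i j => f i j.+1) n.+1.
  have inord0 : inord 0 = ord0 :> 'I_n.+2 by apply: val_inj; rewrite /= inordK.
  have inordm : inord n.+1 = ord_max :> 'I_n.+2 by apply: val_inj; rewrite /= inordK.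
  (* The first and last rows of [P] vanish off the two extreme columns. Expanding along both leaves
     an identity block and the 2 by 2 determinant of the corner entries, which are cofactors of
     [M]. *)
  rewrite ndet_row0max => [|j /andP[j0 jn]]; last first.
    by rewrite /P gtn_eqF// ltn_eqF// ltn_eqF.
  rewrite (@ndet_rowmax _ (fun i j => P i.+1 j.+1)) => [|j jn]; last first.
    by rewrite /P /= !eqSS ltn_eqF// gtn_eqF.
  rewrite (@ndet_rowmax0 _ (fun i j => P i.+1 j)) => [|j /andP[j0 jn]]; last first.
    by rewrite /P gtn_eqF// ltn_eqF// gtn_eqF.
  have P1 : ndet (fun i j => P i.+1 j.+1) n = 1.
    rewrite -[RHS](ndet_delta R n); apply: eq_ndet => i j _ jn.
    by rewrite /P /= !eqSS ltn_eqF.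
  rewrite P1 /P /= !eqxx /a inord0 inordm ![\adj M _ _]mxE.
  rewrite cofactor_00 cofactor_maxmax cofactor_0max cofactor_max0 !mulr1.
  rewrite exprS; set u := (-1) ^+ n.
  (* Two signs come from the cofactors and two from the expansions; one extra factor -1 survives. *)
  have u2 : u * u = 1 by rewrite -exprMn mulrNN mulr1 expr1n.
  rewrite [X in _ = X](_ : _ = ndet f n.+1 * ndet (fun i j => f i.+1 j.+1) n.+1
    - (u * u) * (u * u) * (ndet (fun i j => f i.+1 j) n.+1
                           * ndet (fun i j => f i j.+1) n.+1)).
    ring.
  by rewrite u2 !mul1r.
have detQ : ndet Q n.+2 = ndet f n.+2 * (ndet f n.+2 * ndet (fun i j => f i.+1 j.+1) n).
  rewrite ndet_col0 => [|i /andP[i0 _]]; last by rewrite /Q eqxx gtn_eqF.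
  rewrite (@ndet_colmax _ (fun i j => Q i.+1 j.+1)) => [|i i_n]; last first.
    by rewrite /Q /= eqxx !eqSS ltn_eqF.
  rewrite /Q /= !eqxx; congr (_ * (_ * _)).
  by apply: eq_ndet => i j _ jn; rewrite eqSS ltn_eqF.
by rewrite -detP -detQ /ndet -MPQ det_mulmx.
Qed.

(* The identity is polynomial in the entries, so [f] may be perturbed to
   [f + X I], whose determinant is monic and hence can be cancelled. *)
Lemma desnanot_jacobi (R : idomainType) (f : nat -> nat -> R) n :
  ndet f n.+2 * ndet (fun i j => f i.+1 j.+1) n
  = ndet f n.+1 * ndet (fun i j => f i.+1 j.+1) n.+1
    - ndet (fun i j => f i.+1 j) n.+1 * ndet (fun i j => f i j.+1) n.+1.
Proof.
pose F i j : {poly R} := (f i j)%:P + 'X *+ (i == j).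
have F0 : ndet F n.+2 != 0.
  apply: monic_neq0.
  (* The matrix of [F] is X I - (-M), so its determinant is the characteristic polynomial of -M. *)
  rewrite (_ : ndet F _ = char_poly (- \matrix_(i < n.+2, j < n.+2) f i j)).
    exact: char_poly_monic.
  congr (\det _); apply/matrixP => i j.
  by rewrite !mxE polyCN opprK addrC.
have evalF i j : (F i j).[0] = f i j.
  by rewrite !(hornerE, hornerMn) mul0rn addr0.
(* The index maps cover all shifted minors at once; evaluation at 0 removes X wherever the shift has
   moved it. *)
have eval0 (a b : nat -> nat) m :
    (ndet (fun i j => F (a i) (b j)) m).[0] = ndet (fun i j => f (a i) (b j)) m.
  rewrite [LHS](rmorph_ndet (horner_eval 0)).
  by apply: eq_ndet => i j _ _; exact: evalF.
have eval0F m : (ndet F m).[0] = ndet f m := eval0 id id m.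
have eval0r m : (ndet (fun i j => F i.+1 j) m).[0] = ndet (fun i j => f i.+1 j) m
  := eval0 succn id m.
have eval0c m : (ndet (fun i j => F i j.+1) m).[0] = ndet (fun i j => f i j.+1) m
  := eval0 id succn m.
have /(congr1 (horner^~ 0)) := mulfI F0 (desnanot_jacobi_adj F n).
by rewrite !hornerE !eval0F eval0r eval0c !(eval0 succn succn).
Qed.

(** * Rank-one pencils and the algebraic form of the CKP equation *)

(** The determinant is affine along a rank-one pencil, so its value at 1 is the mean of its values
    at 0 and 2. Bordering the matrix confines the parameter to a single row, where multilinearity
    applies. *)
Lemma ndet_rank1_midpoint (R : fieldType) (f : nat -> nat -> R) (u v : nat -> R) n :
  2 != 0 :> R ->
  ndet f n + ndet (fun i j => f i j - 2 * (u i * v j)) n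
  = 2 * ndet (fun i j => f i j - u i * v j) n.
Proof.
move=> two.
pose r (c : R) : 'rV[R]_n := \row_j (c * v j).
pose B (c : R) : 'M[R]_(1 + n) := block_mx 1%:M (r c) (\col_i u i) (\matrix_(i, j) f i j).
have detB c : \det (B c) = ndet (fun i j => f i j - c * (u i * v j)) n.
  (* Block elimination: the Schur complement of the corner 1 is the rank-one update. *)
  have -> : B c = block_mx 1%:M 0 (\col_i u i) 1%:M
      *m block_mx 1%:M (r c) 0 (\matrix_(i, j) (f i j - c * (u i * v j))).
    rewrite mulmx_block !mul1mx !mul0mx mulmx1 !addr0; congr block_mx.
    apply/matrixP => i j; rewrite !mxE big_ord1 !mxE; ring.
  by rewrite det_mulmx det_lblock det_ublock !det1 !mul1r.
have half : 2^-1 + 2^-1 = 1 :> R by field.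
have : \det (B 1) = 2^-1 * \det (B 0) + 2^-1 * \det (B 2).
  (* Only row 0 depends on [c]. Its corner entry is always 1, which the weights 1/2 and 1/2
     preserve. *)
  apply: (@determinant_multilinear _ _ _ _ _ ord0).
  - apply/matrixP => i j; rewrite !mxE.
    case: (@splitP 1 n ord0) => // k _; rewrite !mxE.
    case: (@splitP 1 n j) => l _; rewrite !mxE -?mulrDl ?half ?mul1r//.
    by field.
  - apply/matrixP => i j; rewrite !mxE; case: (@splitP 1 n (lift ord0 i)) => // k.
    by rewrite lift0 => /eqP; rewrite /= ord1.
  - apply/matrixP => i j; rewrite !mxE; case: (@splitP 1 n (lift ord0 i)) => // k.
    by rewrite lift0 => /eqP; rewrite /= ord1.
rewrite !detB -mulrDr => E.
rewrite [X in X + _ = _](eq_ndet (g := fun i j => f i j - 0 * (u i * v j))); last first.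
  by move=> i j _ _; rewrite mul0r subr0.
rewrite [X in _ = _ * X](eq_ndet (g := fun i j => f i j - 1 * (u i * v j))); last first.
  by move=> i j _ _; rewrite mul1r.
by rewrite E mulrA divff// mul1r.
Qed.

(** The array [h] is the midpoint of the pencil from [f] to [g]. The Desnanot-Jacobi identity at
    [f], [h] and [g], together with the midpoint relations, reduces the claim to polynomial
    algebra. *)
Lemma ckp_of_rank1_update (R : fieldType) (f g : nat -> nat -> R) (p : nat -> R) n :
  2 != 0 :> R -> (forall i j, f i j = f j i) ->
  (forall i j, g i j = f i j - 2 * (p i * p j)) ->
  let f1 i j := f i.+1 j.+1 in
  let g1 i j := g i.+1 j.+1 in
  4 * (ndet f1 n.+1 * ndet f n.+1 - ndet f n.+2 * ndet f1 n)
    * (ndet g1 n.+1 * ndet g n.+1 - ndet g n.+2 * ndet g1 n)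
  = (ndet f1 n.+1 * ndet g n.+1 + ndet g1 n.+1 * ndet f n.+1
     - ndet g n.+2 * ndet f1 n - ndet f n.+2 * ndet g1 n) ^+ 2.
Proof.
move=> two fC gE f1 g1.
pose h i j := f i j - p i * p j.
have gC i j : g i j = g j i by rewrite !gE fC [p i * _]mulrC.
have hC i j : h i j = h j i by rewrite /h fC [p i * _]mulrC.
have dj (k : nat -> nat -> R) : (forall i j, k i j = k j i) ->
    ndet (fun i j => k i.+1 j) n.+1 ^+ 2
    = ndet (fun i j => k i.+1 j.+1) n.+1 * ndet k n.+1
      - ndet k n.+2 * ndet (fun i j => k i.+1 j.+1) n.
  move=> kC; rewrite desnanot_jacobi expr2 -[X in _ * X]ndet_tr.
  rewrite [X in _ * X](eq_ndet (g := fun i j => k i j.+1)) => [|i j _ _]; last exact: kC.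
  by ring.
have mid a b m : ndet (fun i j => f (a i) (b j)) m + ndet (fun i j => g (a i) (b j)) m
    = 2 * ndet (fun i j => h (a i) (b j)) m.
  rewrite -(ndet_rank1_midpoint _ (p \o a) (p \o b))//; congr (_ + _).
  by apply: eq_ndet => i j _ _; exact: gE.
have := mid id id n.+1; have := mid id id n.+2.
have := mid succn succn n.+1; have := mid succn succn n.
have := mid succn id n.+1; rewrite /=.
have := dj f fC; have := dj g gC; have := dj h hC; rewrite -/f1 -/g1.
(* The digits 0, 1, 2 in the new names are the pencil parameters of [f], [h], [g]. *)
move: (ndet f1 n.+1) (ndet f n.+1) (ndet f n.+2) (ndet f1 n) => a0 b0 c0 d0.
move: (ndet g1 n.+1) (ndet g n.+1) (ndet g n.+2) (ndet g1 n) => a2 b2 c2 d2.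
move: (ndet (fun i j => h i.+1 j.+1) n.+1) (ndet h n.+1) => a1 b1.
move: (ndet h n.+2) (ndet (fun i j => h i.+1 j.+1) n) => c1 d1.
set D0 := ndet (fun i j => f i.+1 j) _; set D2 := ndet (fun i j => g i.+1 j) _.
set D1 := ndet (fun i j => h i.+1 j) _.
move=> E1 E2 E0 mD md ma mc mb.
rewrite -E0 -E2.
have -> : a0 * b2 + a2 * b0 - c2 * d0 - c0 * d2 = 2 * D0 * D2.
  (* Polarization: D0 + D2 = 2 D1, and D1 ^ 2 is given by the identity at the midpoint. *)
  have -> : 2 * D0 * D2 = (D0 + D2) ^+ 2 - D0 ^+ 2 - D2 ^+ 2 by ring.
  have -> : (D0 + D2) ^+ 2 = (a0 + a2) * (b0 + b2) - (c0 + c2) * (d0 + d2).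
    rewrite mD ma mb mc md exprMn E1; ring.
  by rewrite E0 E2; ring.
by ring.
Qed.

(** * Measurability, product integrals and an integrable majorant *)

(** On nonnegative reals the inverse is the real power with exponent -1; at 0 both take the default
    value 0. *)
Lemma measurable_funV_ge0 d (T : measurableType d) (R : realType) (D : set T) (f : T -> R) :
  (forall x, D x -> 0 <= f x) -> measurable_fun D f ->
  measurable_fun D (fun x => (f x)^-1).
Proof.
move=> f0 mf; apply: (eq_measurable_fun (fun x => f x `^ (-1))).
  by move=> x /set_mem Dx; rewrite powR_inv1// f0.
exact: (@measurableT_comp _ _ _ _ _ _ (@powR R ^~ (-1)) _ _ (measurable_powR (-1)) mf).
Qed.

Section Product.
Context d1 d2 (T1 : measurableType d1) (T2 : measurableType d2) (R : realType).
Variables (m1 : {sigma_finite_measure set T1 -> \bar R}).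
Variables (m2 : {sigma_finite_measure set T2 -> \bar R}).
Variables (A : set T1) (B : set T2) (u : T1 -> R) (v : T2 -> R).
Hypotheses (mA : measurable A) (mB : measurable B).
Hypothesis iu : m1.-integrable A (EFin \o u).
Hypothesis iv : m2.-integrable B (EFin \o v).

(** Extension by zero allows Fubini's theorem to be used on the whole product space. *)
Let f (p : T1 * T2) : \bar R := ((u \_ A) p.1 * (v \_ B) p.2)%:E.

Let iu' : m1.-integrable setT (EFin \o (u \_ A)).
Proof. by rewrite -restrict_EFin; apply/(integrable_mkcond _ mA). Qed.

Let iv' : m2.-integrable setT (EFin \o (v \_ B)).
Proof. by rewrite -restrict_EFin; apply/(integrable_mkcond _ mB). Qed.

Let mf : measurable_fun setT f.
Proof.
apply/measurable_EFinP; apply: measurable_funM.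
  by apply: measurableT_comp => //; apply/measurable_EFinP; exact: measurable_int iu'.
by apply: measurableT_comp => //; apply/measurable_EFinP; exact: measurable_int iv'.
Qed.

Let fE : EFin \o (fun p => u p.1 * v p.2) \_ (A `*` B) = f.
Proof.
apply/funext => -[x y]; rewrite /f /= !patchE in_setX /=.
by case: (x \in A); case: (y \in B); rewrite /= ?mul0r ?mulr0.
Qed.

Let if_ : (m1 \x m2)%E.-integrable setT f.
Proof.
apply/integrable12ltyP => //.
have [iu1 iv1] := (integrable_abse iu', integrable_abse iv').
(* The iterated integral of the absolute value factors into two finite integrals; [fineK] exposes
   each as a real constant that can be pulled out. *)
under eq_integral => x _.
  rewrite /f/=; under eq_integral do rewrite normrM EFinM.
  rewrite (integralZl measurableT iv1) -(fineK (integrable_fin_num measurableT iv1)).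
  over.
rewrite (integralZr measurableT iu1) -(fineK (integrable_fin_num measurableT iu1)).
by rewrite -EFinM ltry.
Qed.

Lemma integrable_prod_setX :
  (m1 \x m2)%E.-integrable (A `*` B) (EFin \o (fun p => u p.1 * v p.2)).
Proof.
apply/integrable_mkcond; first exact: measurableX.
by rewrite restrict_EFin fE.
Qed.

Lemma Rintegral_prod_setX :
  Rintegral (m1 \x m2)%E (A `*` B) (fun p => u p.1 * v p.2)
  = Rintegral m1 A u * Rintegral m2 B v.
Proof.
rewrite (Rintegral_mkcond _ A) (Rintegral_mkcond _ B) (Rintegral_mkcond _ (A `*` B)).
rewrite /Rintegral -[X in integral _ _ X]/(EFin \o _) fE -integral12_prod_meas1//.
rewrite [in LHS](eq_integral (fun x => ((u \_ A) x)%:E * (Rintegral m2 setT (v \_ B))%:E)%E).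
  rewrite (integralZr measurableT iu') -(fineK (integrable_fin_num measurableT iu')).
  by rewrite -EFinM.
move=> x _; rewrite /fubini_F /f /=; under eq_integral do rewrite EFinM.
by rewrite (integralZl measurableT iv') -(fineK (integrable_fin_num measurableT iv')).
Qed.

End Product.

Lemma integral_invsqrt_itvcc (R : realType) (e : R) : 0 < e < 1 ->
  (\int[@lebesgue_measure R]_(x in `[e, 1%R]) ((Num.sqrt x)^-1)%:E
   = (2 * Num.sqrt 1)%:E - (2 * Num.sqrt e)%:E)%E.
Proof.
move=> /andP[e0 e1].
have ein x : x \in `[e, 1] -> 0 < x.
  by rewrite in_itv/= => /andP[+ _]; exact: lt_le_trans.
have cF : continuous (fun x : R => 2 * Num.sqrt x).
  by move=> x; apply: cvgMr; exact: sqrt_continuous.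
apply: (continuous_FTC2 (F := fun x => 2 * Num.sqrt x)) => //.
- apply: continuous_in_subspaceT => x /set_mem/= /ein x0.
  apply: cvgV; first by rewrite gt_eqF// sqrtr_gt0.
  exact: sqrt_continuous.
- split.
  + move=> x /subset_itv_oo_cc/ein x0.
    have dx := is_derive1_sqrt x0. apply: derivableM; first exact: derivable_cst.
    exact: ex_derive.
  + by apply: cvg_at_right_filter; exact: cF.
  + by apply: cvg_at_left_filter; exact: cF.
- move=> x /subset_itv_oo_cc/ein x0.
  have dx := is_derive1_sqrt x0.
  rewrite derive1E deriveM// derive_cst derive_sqrt//.
  by rewrite scaler0 addr0 invfM scalerA divff ?pnatr_eq0// scale1r.
Qed.

(** Monotone convergence along intervals increasing to the open unit interval: by the primitive 2
    sqrt x, each integral is at most 2. *)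
Lemma integrable_invsqrt01 (R : realType) :
  (@lebesgue_measure R).-integrable `]0%R, 1%R[ (fun x => (Num.sqrt x)^-1%:E).
Proof.
have mf : measurable_fun (`]0%R, 1%R[%classic : set R) (fun x => (Num.sqrt x)^-1).
  apply: measurable_funV_ge0 => // ; apply: measurable_funTS.
  exact: (continuous_measurable_fun (@sqrt_continuous R)).
apply/integrableP; split; first exact/measurable_EFinP.
under eq_integral => x _ do rewrite gee0_abs ?lee_fin ?invr_ge0 ?sqrtr_ge0//.
(* The offset 2 keeps the left end point strictly below 1. *)
pose F i : set R := `[i.+2%:R^-1, 1%R[%classic.
have FU : \bigcup_i F i = `]0, 1[%classic.
  apply/seteqP; split => x /=; rewrite in_itv/=.
    move=> [i _]; rewrite /F/= in_itv/= => /andP[ix ->]; rewrite andbT.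
    by apply: lt_le_trans ix; rewrite invr_gt0.
  move=> /andP[x0 x1]; have [N _ /(_ N (leqnn N)) Nx] := near_infty_natSinv_lt (PosNum x0).
  exists N => //; rewrite /F/= in_itv/= x1 andbT (le_trans _ (ltW Nx))//.
  by rewrite lef_pV2 ?posrE// ler_nat.
have FS i : F i `<=` `]0, 1[%classic by rewrite -FU; exact: bigcup_sup.
have Fnd : nondecreasing_seq F.
  apply/nondecreasing_seqP => i; apply/subsetPset => x; rewrite /F /= !in_itv/=.
  move=> /andP[ix ->]; rewrite andbT; apply: le_trans ix.
  by rewrite lef_pV2 ?posrE// ler_nat.
have mF i : measurable (F i) by exact: measurable_itv.
rewrite -FU; apply: (@le_lt_trans _ _ 2%:E); last exact: ltry.
have cvgF : (\int[@lebesgue_measure R]_(x in F i) (Num.sqrt x)^-1%:E @[i --> \oo]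
    --> \int[@lebesgue_measure R]_(x in \bigcup_i F i) (Num.sqrt x)^-1%:E)%E.
  apply: ge0_nondecreasing_set_cvg_integral => // i.
  by apply/measurable_EFinP; apply: measurable_funS mf => //; exact: FS.
apply: cvge_le cvgF; apply: nearW => i.
have e01 : 0 < (i.+2%:R^-1 : R) < 1.
  by rewrite invr_gt0 ltr0n invf_lt1 ?ltr0n// ltr1n.
rewrite integral_itv_bndo_bndc; last first.
  apply/measurable_EFinP; apply: measurable_funS mf => //; exact: FS.
rewrite [leLHS](integral_invsqrt_itvcc e01).
by rewrite -EFinB lee_fin sqrtr1 mulr1 gerBl mulr_ge0.
Qed.

(** * Bimoments of the deformed Jacobi weight *)

Section Jacobi.
Variable R : realType.
Local Notation mu := (@lebesgue_measure R).
Local Notation I := (`]0%R, 1%R[%classic : set R).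
Implicit Types (a b s t : nat) (x : R) (p : R * R).

Lemma djac_ge0_le1 t x : I x -> 0 <= djac t x <= 1.
Proof.
rewrite /= in_itv/= => /andP[x0 x1]; have xp : 0 < 1 + x by lra.
have h0 : 0 <= (1 - x) / (1 + x) by rewrite divr_ge0//; lra.
rewrite /djac exprn_ge0//= exprn_ile1// ler_pdivrMr//; lra.
Qed.

Lemma measurable_djac t : measurable_fun I (djac t : R -> R).
Proof.
apply: measurable_funX; apply: measurable_funM; first exact: measurable_funB.
apply: measurable_funV_ge0; last exact: measurable_funD.
by move=> x /=; rewrite in_itv/= => /andP[x0 _]; lra.
Qed.

(** With [a] equal to s + i, this is the integrand of the vector p_i in the rank-one term. *)
Definition jac1 t a x : R := x ^+ a / (1 + x) * djac t x.

Definition jac2 t a b p : R :=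
  p.1 ^+ a * p.2 ^+ b / (p.1 + p.2) * djac t p.1 * djac t p.2.

Lemma jac1_ge0_le1 t a x : I x -> 0 <= jac1 t a x <= 1.
Proof.
move=> Ix; have /andP[w0 w1] := djac_ge0_le1 t Ix.
move: Ix; rewrite /= in_itv/= => /andP[x0 x1]; have xp : 0 < 1 + x by lra.
have a0 : 0 <= x ^+ a by rewrite exprn_ge0// ltW.
have a1 : x ^+ a <= 1 by rewrite exprn_ile1// ltW.
have h0 : 0 <= x ^+ a / (1 + x) by rewrite divr_ge0// ltW.
by rewrite /jac1 mulr_ge0//= mulr_ile1// ler_pdivrMr//; lra.
Qed.

Lemma integrable_jac1 t a : mu.-integrable I (EFin \o jac1 t a).
Proof.
apply: (@le_integrable _ _ _ _ _ _ _ (EFin \o cst 1)) => //.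
- apply/measurable_EFinP; apply: measurable_funM; last exact: measurable_djac.
  apply: measurable_funM; first exact: measurable_funX.
  apply: measurable_funV_ge0; last exact: measurable_funD.
  by move=> x /=; rewrite in_itv/= => /andP[x0 _]; lra.
- move=> x Ix; have /andP[? ?] := jac1_ge0_le1 t a Ix.
  by rewrite lee_fin ger0_norm// normr1.
- apply: measurable_bounded_integrable => //; last exact: bounded_cst.
  by rewrite /= lebesgue_measure_itv/= lte_fin ltr01 -EFinD ltry.
Qed.

Lemma measurable_jac2 t a b : measurable_fun (I `*` I) (jac2 t a b).
Proof.
have m1 : measurable_fun (I `*` I) (fun p : R * R => p.1) by apply: measurable_funTS; exact: measurable_fst.
have m2 : measurable_fun (I `*` I) (fun p : R * R => p.2) by apply: measurable_funTS; exact: measurable_snd.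
have md := measurable_djac t.
apply: measurable_funM; last first.
  (* The weight is known to be measurable only on [I], into which the projections map the square. *)
  by apply: (measurable_comp (F := I)) => // _ [[x y] [_ ?] <-].
apply: measurable_funM; last first.
  by apply: (measurable_comp (F := I)) => // _ [[x y] [? _] <-].
apply: measurable_funM.
  by apply: measurable_funM; apply: measurable_funX.
apply: measurable_funV_ge0; last exact: measurable_funD.
by case=> x y [] /=; rewrite !in_itv/= => /andP[x0 _] /andP[y0 _]; lra.
Qed.

Lemma jac2_ge0 t a b p : (I `*` I) p -> 0 <= jac2 t a b p.
Proof.
case: p => x y [] Ix Iy /=.
have [/andP[wx _] /andP[wy _]] := (djac_ge0_le1 t Ix, djac_ge0_le1 t Iy).
move: Ix Iy; rewrite /= !in_itv/= => /andP[x0 _] /andP[y0 _].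
by rewrite /jac2 /= mulr_ge0// mulr_ge0// divr_ge0 ?mulr_ge0 ?exprn_ge0//; lra.
Qed.

(* The kernel is singular at the origin; x + y >= sqrt x * sqrt y separates
   the variables. *)
Lemma jac2_le t a b p : (I `*` I) p ->
  jac2 t a b p <= (Num.sqrt p.1)^-1 * (Num.sqrt p.2)^-1.
Proof.
case: p => x y [] Ix Iy /=.
have [/andP[wx wx1] /andP[wy wy1]] := (djac_ge0_le1 t Ix, djac_ge0_le1 t Iy).
move: Ix Iy; rewrite /= !in_itv/= => /andP[x0 x1] /andP[y0 y1].
have xa : 0 <= x ^+ a <= 1 by rewrite exprn_ge0 ?exprn_ile1// ltW.
have yb : 0 <= y ^+ b <= 1 by rewrite exprn_ge0 ?exprn_ile1// ltW.
have [sx sy] : 0 < Num.sqrt x /\ 0 < Num.sqrt y by rewrite !sqrtr_gt0.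
have le1 : x ^+ a * y ^+ b * djac t x * djac t y <= 1.
  by move: xa yb => /andP[? ?] /andP[? ?]; rewrite !mulr_ile1 ?mulr_ge0.
have le2 : Num.sqrt x * Num.sqrt y <= x + y.
  move: sx sy (sqr_sqrtr (ltW x0)) (sqr_sqrtr (ltW y0)).
  (* With u and v the square roots, the claim is u v <= u ^ 2 + v ^ 2. *)
  by move: (Num.sqrt x) (Num.sqrt y) => u v u0 v0 <- <-; clear; nra.
rewrite -invfM /jac2 /=.
rewrite (_ : _ * _ = (x ^+ a * y ^+ b * djac t x * djac t y) / (x + y)); last by ring.
apply: (@le_trans _ _ (x + y)^-1).
  by rewrite ler_piMl// invr_ge0; lra.
by rewrite lef_pV2// posrE ?mulr_gt0//; lra.
Qed.

Lemma integrable_jac2 t a b :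
  (mu \x mu)%E.-integrable (I `*` I) (EFin \o jac2 t a b).
Proof.
have := integrable_prod_setX _ _ (integrable_invsqrt01 R) (integrable_invsqrt01 R).
move=> /(_ (measurable_itv _) (measurable_itv _)).
apply: le_integrable => //.
- exact: measurableX.
- by apply/measurable_EFinP; exact: measurable_jac2.
- move=> p Ip /=; rewrite lee_fin ger0_norm ?jac2_ge0// ger0_norm.
    exact: jac2_le.
  by rewrite mulr_ge0// invr_ge0 sqrtr_ge0.
Qed.

Lemma jac2_swap t a b x y : jac2 t a b (x, y) = jac2 t b a (y, x).
Proof. by rewrite /jac2 /= [y + x]addrC; ring. Qed.

Lemma bimomentE s t i j :
  bimoment R s t i j = Rintegral (mu \x mu)%E (I `*` I) (jac2 t (s + i) (s + j)).
Proof. by []. Qed.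

(** Fubini's theorem is applied in opposite orders on the two sides; exchanging the variables then
    matches the integrands pointwise. *)
Lemma bimomentC s t i j : bimoment R s t i j = bimoment R s t j i.
Proof.
have int0 a b : (mu \x mu)%E.-integrable setT (EFin \o jac2 t a b \_ (I `*` I)).
  rewrite -restrict_EFin; apply: (iffLR (integrable_mkcond _ _)); last exact: integrable_jac2.
  exact: measurableX.
rewrite !bimomentE [LHS]Rintegral_mkcond [RHS]Rintegral_mkcond /Rintegral.
rewrite -[X in fine X = _]integral12_prod_meas1; last exact: int0.
rewrite -[X in _ = fine X]integral21_prod_meas1; last exact: int0.
congr fine; apply: eq_integral => x _; apply: eq_integral => y _.
rewrite /= !patchE !in_setX /= andbC; case: ifP => // _.
by congr EFin; exact: jac2_swap.
Qed.

(** In (1-x)(1-y) = (1+x)(1+y) - 2(x+y) the last term cancels the Cauchy kernel, so the correction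
    separates the variables. *)
Lemma jac2S t a b p : (I `*` I) p ->
  jac2 t.+1 a b p = jac2 t a b p - 2 * (jac1 t a p.1 * jac1 t b p.2).
Proof.
case: p => x y [] /=; rewrite !in_itv/= => /andP[x0 x1] /andP[y0 y1].
rewrite /jac2 /jac1 /djac /= !exprSr; field.
by rewrite !gt_eqF//=; lra.
Qed.

Lemma bimomentS s t i j : bimoment R s t.+1 i j
  = bimoment R s t i j
    - 2 * (Rintegral mu I (jac1 t (s + i)) * Rintegral mu I (jac1 t (s + j))).
Proof.
have := integrable_prod_setX _ _ (integrable_jac1 t (s + i)) (integrable_jac1 t (s + j)).
move=> /(_ (measurable_itv _) (measurable_itv _)) ij.
rewrite !bimomentE -Rintegral_prod_setX//; [|exact: integrable_jac1..].
rewrite -RintegralZl//; last exact: measurableX.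
rewrite -RintegralB; [|exact: measurableX|exact: integrable_jac2|].
- by apply: eq_Rintegral => p /set_mem; exact: jac2S.
- by apply: integrableZl ij; exact: measurableX.
Qed.

End Jacobi.

(** * Specialization to the bimoments *)

(** The parameter s enters only through s + i and s + j, so raising it deletes the first row and
    column of the infinite array. *)
Lemma bimoment_shift (R : realType) s t i j :
  bimoment R s.+1 t i j = bimoment R s t i.+1 j.+1.
Proof. by rewrite !bimomentE !addSnnS. Qed.

Theorem theorem3p4 (R : realType) (n s t : nat) : (1 <= n)%N ->
  4 * (tau R s.+1 t n * tau R s t n - tau R s t n.+1 * tau R s.+1 t n.-1)
    * (tau R s.+1 t.+1 n * tau R s t.+1 n - tau R s t.+1 n.+1 * tau R s.+1 t.+1 n.-1)
  = (tau R s.+1 t n * tau R s t.+1 n + tau R s.+1 t.+1 n * tau R s t n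
     - tau R s t.+1 n.+1 * tau R s.+1 t n.-1
     - tau R s t n.+1 * tau R s.+1 t.+1 n.-1) ^+ 2.
Proof.
(* Replacing n by its successor turns the truncated predecessor in the statement into the new n. *)
case: n => // n _.
have tauE s' t' m : tau R s' t' m = ndet (bimoment R s' t') m by [].
have tauS t' m : tau R s.+1 t' m = ndet (fun i j => bimoment R s t' i.+1 j.+1) m.
  by rewrite tauE; apply: eq_ndet => i j _ _; exact: bimoment_shift.
rewrite !tauS !tauE /=.
apply: ckp_of_rank1_update; first by rewrite pnatr_eq0.
  exact: bimomentC.
exact: bimomentS.
Qed.
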